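(* Let $\mathcal{G}=(G,p)$ be an infinite locally finite framework in $\mathbb{R}^2$ with connected graph $G=(V,E)$, $V=\{v_1,v_2,\dots\}$, and with normalised framework vector $p=(p_1,p_2,\dots)$. Let $(G_1,p)\subseteq (G_2,p)\subseteq\cdots$ be a standard chain for $(G,p)$ and let $v_i,v_j$ be vertices of $G_1$. Suppose that there exist $M>0$ and $c>0$ and a sequence of $M$-smooth normalised flexes $p^{(r)}(t)$ of $(G_r,p)$, for $r=1,2,\dots$, such that for all $r$ $$\left|d^{(r)}_{i,j}(1)-d^{(r)}_{i,j}(0)\right|\ \geq\ c,$$ where $d^{(r)}_{i,j}(t)=|p^{(r)}_i(t)-p^{(r)}_j(t)|$. Then $(G,p)$ is continuously flexible.
   Context: A (bar-joint) framework in $\mathbb{R}^2$ is a pair $(G,p)$ where $G=(V,E)$ is a graph with countable vertex set $V=\{v_1,v_2,\dots\}$ and edge set $E$, and $p=(p_1,p_2,\dots)$ with $p_i\in\mathbb{R}^2$ is the framework vector ($p_i$ is the position of $v_i$). It is infinite if $V$ is countably infinite, and locally finite if each vertex has finite degree. $|\cdot|$ is the Euclidean norm. Normalised: $e_1=(v_1,v_2)$ is an edge of $G$ with length $d_{e_1}=|p_1-p_2|\neq 0$, and $p_1=(0,0)$, $p_2=(d_{e_1},0)$. Standard chain: a sequence $(G_1,p)\subseteq (G_2,p)\subseteq\cdots$ of vertex-induced connected subframeworks (each $G_r$ is the connected subgraph of $G$ induced by some vertex set $V_r$, with positions given by the restriction of $p$) whose union is $(G,p)$. Continuous flex: for a framework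 $(H,p)$ with connected graph $H$ and vertex set $W$, a (proper) continuous flex is a function $t\mapsto p(t)=(p_i(t))_{v_i\in W}$ from $[0,1]$ to $\prod_{W}\mathbb{R}^2$ such that (i) $p(0)=p$; (ii) each coordinate function $p_i(t)$ is continuous; (iii) for some base edge $(v_a,v_b)$ with $|p_a-p_b|\ne 0$, $p_a(t)=p_a(0)$ and $p_b(t)=p_b(0)$ for all $t$; (iv) $|p_i(t)-p_j(t)|=|p_i(0)-p_j(0)|$ for all edges $(v_i,v_j)$ and all $t$; (v) $p(t)$ is not a constant function. The framework is continuously flexible if it has a (proper) continuous flex. Normalised flex: a flex for which the base edge in (iii) is $(v_1,v_2)$, i.e. $p_1(t)=p_1$ and $p_2(t)=p_2$ for all $t$ (in particular $v_1,v_2$ are vertices of the framework being flexed). $M$-smooth flex: a continuous flex $p(t)$ such that each $p_i(t)$ is differentiable on $[0,1]$ with continuous derivative (one-sided derivatives at $0$ and $1$), and such that for every pair of vertices $v_i,v_j$ of the framework (not only adjacent ones) the distance function $d_{ij}(t)=|p_i(t)-p_j(t)|$ has bounded derivative with $|d_{ij}'(t)|\le M$ for all $t\in[0,1]$. *)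

(* Defs.v *)
From HB Require Import structures.
From mathcomp Require Import all_boot all_order all_algebra.
From mathcomp Require Import all_classical all_reals all_analysis.
Import Order.TTheory GRing.Theory Num.Theory.
Import numFieldNormedType.Exports.

Set Implicit Arguments.
Unset Strict Implicit.
Unset Printing Implicit Defensive.

Local Open Scope classical_set_scope.
Local Open Scope ring_scope.

(* The library norm on R * R is the sup norm, hence this explicit Euclidean
   distance; the product topology is the usual topology of the plane. *)
Definition eucl_dist (R : realType) (x y : R * R) : R :=
  Num.sqrt ((x.1 - y.1) ^+ 2 + (x.2 - y.2) ^+ 2).

(* Derivative at x relative to D, with increments restricted to D.  For
   D = `[0, 1] it is the usual derivative at interior points and the one-sided
   derivative at 0 and 1. *)
Definition has_derivative_in (R : realType) (U : normedModType R)
    (D : set R) (f : R -> U) (x : R) (l : U) : Prop :=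
  (y - x)^-1 *: (f y - f x) @[y --> within D x^'] --> l.

Definition C1_in (R : realType) (U : normedModType R)
    (D : set R) (f : R -> U) : Prop :=
  exists f' : R -> U,
    (forall x, D x -> has_derivative_in D f x (f' x)) /\
    {within D, continuous f'}.

(* The framework's graph has vertex set all of T; the vertex-induced
   subframework on W : set T is referred to by the pair (F, W), the whole
   framework being W = setT. *)
Record framework (R : realType) (T : eqType) := Framework {
  adj : rel T;
  adj_sym : symmetric adj;
  adj_irr : irreflexive adj;
  pos : T -> R * R
}.

Section Frameworks.
Context (R : realType) (T : eqType).
Implicit Types (F : framework R T) (W : set T) (q : R -> T -> R * R).

Definition induced_connected F W : Prop :=
  forall x y, W x -> W y ->
    exists s : seq T,
      [/\ path (adj F) x s, last x s = y & [set` s] `<=` W].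

Definition locally_finite F : Prop :=
  forall x, finite_set [set y | adj F x y].

(* A flex q of (F, W) assigns to a time t and a vertex x the position q t x;
   only times in [0, 1] and vertices in W matter. *)
Definition flex_with_base F W (a b : T) q : Prop :=
  [/\ (forall x, W x -> q 0 x = pos F x),
      (forall x, W x -> {within `[0, 1], continuous (fun t => q t x)}),
      [/\ W a, W b, adj F a b, eucl_dist (pos F a) (pos F b) != 0 &
          forall t : R, t \in `[0, 1] -> q t a = q 0 a /\ q t b = q 0 b],
      (forall x y, W x -> W y -> adj F x y ->
        forall t : R, t \in `[0, 1] ->
          eucl_dist (q t x) (q t y) = eucl_dist (q 0 x) (q 0 y)) &
      ~ (forall s t : R, s \in `[0, 1] -> t \in `[0, 1] ->
          forall x, W x -> q s x = q t x)].

Definition continuous_flex F W q : Prop :=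
  exists a b : T, flex_with_base F W a b q.

Definition continuously_flexible F W : Prop :=
  exists q, continuous_flex F W q.

Definition smooth_flex F W (M : R) q : Prop :=
  [/\ continuous_flex F W q,
      (forall x, W x -> C1_in `[0, 1] (fun t => q t x)) &
      (forall x y, W x -> W y -> forall t : R, t \in `[0, 1] ->
        exists2 l : R,
          has_derivative_in `[0, 1] (fun s => eucl_dist (q s x) (q s y)) t l &
          `|l| <= M)].

Definition standard_chain F (V : nat -> set T) : Prop :=
  [/\ (forall r, V r `<=` V r.+1),
      (forall r, induced_connected F (V r)),
      \bigcup_r V r = setT &
      (forall x y, adj F x y -> exists r, V r x /\ V r y)].

End Frameworks.

(* Vertices are indexed from 0: v_1, v_2, v_3, ... are 0, 1, 2, ... : nat. *)
Definition normalised_framework (R : realType) (F : framework R nat) : Prop :=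
  [/\ adj F 0%N 1%N,
      eucl_dist (pos F 0%N) (pos F 1%N) != 0,
      pos F 0%N = (0, 0) &
      pos F 1%N = (eucl_dist (pos F 0%N) (pos F 1%N), 0)].

Definition normalised_flex (R : realType) (F : framework R nat) (W : set nat)
    (q : R -> nat -> R * R) : Prop :=
  flex_with_base F W 0%N 1%N q.

(* Main.v *)
Require Import Defs.
From HB Require Import structures.
From mathcomp Require Import all_boot all_order all_algebra.
From mathcomp Require Import all_classical all_reals all_analysis.
From mathcomp Require Import ring lra.
Import Order.TTheory GRing.Theory Num.Theory.
Import numFieldNormedType.Exports.
Local Open Scope classical_set_scope.
Local Open Scope ring_scope.

(** In a normalised flex the vertices [v_1] and [v_2] stay at [(0, 0)] and
    [(d, 0)] with [d > 0], so the position [(X, Y)] of any other vertex is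
    known, up to the sign of [Y], from its distances [r0] and [r1] to them:
    [2 d X = r0^2 - r1^2 + d^2] and [Y^2 = r0^2 - X^2].  By the mean value
    theorem these distances are [M]-Lipschitz, with initial values that depend
    only on the framework; hence [X] and [Y^2] are bounded and Lipschitz, with
    constants independent of the flex.  The function [Y] itself is then
    Hoelder of exponent 1/2: it can change sign only through a zero, so
    control of [Y^2] suffices ([sqr_dist_le_of_sqr_lipschitz]).  Thus the
    coordinates of each vertex are bounded and equicontinuous along the whole
    sequence of flexes ([normalised_smooth_flex_bound]).

    A limit of the flexes is usually extracted by the Arzela-Ascoli theorem
    and a diagonal argument over the vertices.  Here all coordinates at all
    times converge at once along a fixed ultrafilter on the indices that
    contains the cofinite sets; the uniform Hoelder estimates pass to the
    pointwise limit and make it continuous ([bounded_half_holder_limit]).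
    Each vertex lies in all but finitely many members of the chain, so the
    limit is defined at every vertex, starts at the given positions, fixes the
    base edge and preserves the edge lengths.  The lower bound [c] on the
    change of the distance between [v_i] and [v_j] also survives in the limit,
    so the limit flex is not constant. *)

(** * Lipschitz and Hoelder estimates *)

Lemma is_derive_of_has_derivative_in {R : realType} {D : set R} {f : R -> R}
    {x l : R} :
  nbhs x D -> has_derivative_in D f x l -> is_derive x 1 f l.
Proof.
move=> nD fl.
have fl0 : h^-1 *: ((f \o shift x) (h *: 1) - f x) @[h --> 0^'] --> l.
  apply/cvgrPdist_le => e e0.
  move/cvgrPdist_le : fl => /(_ e e0).
  rewrite !near_withinE /= => H.
  have : \forall y \near x, y != x ->
      `|l - (y - x)^-1 *: (f y - f x)| <= e.
    near=> y => yx.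
    by apply: (near H y) => //; exact: (near nD y).
  rewrite (near_shift 0) => H'.
  apply: filterS H' => h /= H' h0.
  have := H'; rewrite subr0 /shift /= addrK -subr_eq0 addrK => /(_ h0).
  by rewrite /= /GRing.scale /= mulr1.
apply: DeriveDef; first by apply/cvg_ex; exists l.
exact: cvg_lim.
Unshelve. all: by end_near.
Qed.

(** Mean value inequality.  The derivative along [`[a, b]] is an ordinary
    derivative at interior points, and these are the only points at which the
    mean value theorem needs one. *)
Lemma lipschitz_of_derivative_bound {R : realType} {f : R -> R} {a b M : R} :
    {within `[a, b], continuous f} ->
    (forall t, t \in `[a, b] ->
      exists2 l, has_derivative_in `[a, b] f t l & `|l| <= M) ->
  forall s t, s \in `[a, b] -> t \in `[a, b] ->
    `|f s - f t| <= M * `|s - t|.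
Proof.
move=> fc fd s t; wlog st : s t / s <= t => [wl|] sab tab.
  have [st|/ltW ts] := leP s t; first exact: wl.
  by rewrite distrC (distrC s); exact: wl.
pose df t := 'D_1 f t.
have fdf x : x \in `]s, t[ -> is_derive x 1 f (df x) /\ `|df x| <= M.
  move=> xst.
  have xab : x \in `]a, b[.
    move: sab tab xst; rewrite !in_itv /= => /andP[? ?] /andP[? ?] /andP[? ?].
    by apply/andP; split; lra.
  have [l fl lM] := fd x (subset_itv_oo_cc xab).
  have nab : nbhs x `[a, b]%classic.
    apply: filterS (near_in_itvoo xab) => y; exact: subset_itv_oo_cc.
  have dl := is_derive_of_has_derivative_in nab fl.
  have -> : df x = l by rewrite /df derive_val.
  by [].
move: st; rewrite le_eqVlt => /predU1P[->|st]; first by rewrite !subrr normr0 mulr0.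
have fcst : {within `[s, t], continuous f}.
  apply: continuous_subspaceW fc => y /=; move: sab tab; rewrite !in_itv /=.
  by move=> /andP[? ?] /andP[? ?] /andP[? ?]; apply/andP; split; lra.
have [c cst E] := MVT st (fun x xst => (fdf x xst).1) fcst.
by rewrite distrC E normrM (distrC s) ler_wpM2r// (fdf c cst).2.
Qed.

(** If [f s] and [f t] have the same sign, then [`|f s - f t| <= `|f s + f t|]
    and the product of the two is [`|f s ^+ 2 - f t ^+ 2|].  Otherwise [f]
    vanishes at some [c] between [s] and [t], and comparing both values with
    [f c = 0] bounds [f s ^+ 2 + f t ^+ 2] by [K * `|s - t|]. *)
Lemma sqr_dist_le_of_sqr_lipschitz {R : realType} {f : R -> R} {a b K : R} :
    {within `[a, b], continuous f} ->
    (forall s t, s \in `[a, b] -> t \in `[a, b] ->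
      `|f s ^+ 2 - f t ^+ 2| <= K * `|s - t|) ->
  forall s t, s \in `[a, b] -> t \in `[a, b] ->
    (f s - f t) ^+ 2 <= 2 * K * `|s - t|.
Proof.
move=> fc fK s t; wlog st : s t / s <= t => [wl|] sab tab.
  have [st|/ltW ts] := leP s t; first exact: wl.
  by rewrite -sqrrN opprB (distrC s); exact: wl.
have Kst := fK _ _ sab tab.
have [ge0|lt0] := leP 0 (f s * f t).
  suff : (f s - f t) ^+ 2 <= `|f s ^+ 2 - f t ^+ 2|.
    by have := normr_ge0 (f s ^+ 2 - f t ^+ 2); lra.
  rewrite subr_sqr normrM -real_normK ?num_real// expr2 ler_wpM2l//.
  by rewrite -ler_sqr ?nnegrE// !real_normK ?num_real//; nra.
have fcst : {within `[s, t], continuous f}.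
  apply: continuous_subspaceW fc => y /=; move: sab tab; rewrite !in_itv /=.
  by move=> /andP[? ?] /andP[? ?] /andP[? ?]; apply/andP; split; lra.
have [|c cst fc0] := @IVT _ f s t 0 st fcst.
  rewrite ge_min le_max.
  by have [?|?] := leP (f s) 0; have [?|?] := leP (f t) 0 => //=; nra.
have cab : c \in `[a, b].
  move: sab tab cst; rewrite !in_itv /= => /andP[? ?] /andP[? ?] /andP[? ?].
  by apply/andP; split; lra.
have := fK _ _ sab cab; have := fK _ _ tab cab.
rewrite fc0 expr0n !subr0 !(ger0_norm (sqr_ge0 _)).
move: cst; rewrite in_itv /= => /andP[sc ct].
rewrite (ler0_norm (_ : s - c <= 0)) ?subr_le0// (ler0_norm (_ : s - t <= 0)) ?subr_le0//.
rewrite (ger0_norm (_ : 0 <= t - c)) ?subr_ge0//.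
have := sqr_ge0 (f s + f t); lra.
Qed.

Lemma within_continuous_of_sqr_dist_le {R : realType} (f : R -> R) (D : set R) (K : R) :
    (forall s t, D s -> D t -> (f s - f t) ^+ 2 <= K * `|s - t|) ->
  {within D, continuous f}.
Proof.
move=> fK; apply/subspace_continuousP => t Dt.
apply/cvgrPdist_le => e e0; rewrite near_withinE.
pose d := e ^+ 2 / (`|K| + 1).
have K1 : 0 < `|K| + 1 by rewrite ltr_wpDl.
have d0 : 0 < d by rewrite divr_gt0// exprn_gt0.
near=> s => Ds.
have ts : `|t - s| <= d by near: s; apply: cvgr_dist_le d0; exact: cvg_id.
rewrite -ler_sqr ?nnegrE// ?(ltW e0)// -normrX ger0_norm ?sqr_ge0//.
apply: le_trans (fK _ _ Dt Ds) _.
have -> : e ^+ 2 = (`|K| + 1) * d by rewrite mulrC divfK// gt_eqF.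
apply: (@le_trans _ _ (`|K| * `|t - s|)).
  by rewrite ler_wpM2r// ler_norm.
by apply: ler_pM => //; rewrite lerDl.
Unshelve. all: by end_near.
Qed.

Lemma sqr_lipschitz {R : realType} {u : R -> R} {D : set R} {B M : R} :
    (forall t, D t -> `|u t| <= B) ->
    (forall s t, D s -> D t -> `|u s - u t| <= M * `|s - t|) ->
  forall s t, D s -> D t -> `|u s ^+ 2 - u t ^+ 2| <= 2 * B * M * `|s - t|.
Proof.
move=> uB uM s t Ds Dt; rewrite subr_sqr normrM.
have -> : 2 * B * M * `|s - t| = (M * `|s - t|) * (B + B) by ring.
apply: ler_pM => //; first exact: uM.
by rewrite (le_trans (ler_normD _ _))// lerD// uB.
Qed.

(** * The Euclidean distance *)

Lemma cvg_eucl_dist {R : realType} (T : Type) (G : set_system T) (FG : Filter G)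
    (f g : T -> R * R) (x y : R * R) :
  f @ G --> x -> g @ G --> y ->
  eucl_dist (f z) (g z) @[z --> G] --> eucl_dist x y.
Proof.
move=> fx gy.
have fst_cvg h (w : R * R) : h @ G --> w -> (h z).1 @[z --> G] --> w.1.
  by move=> hw; apply: cvg_comp hw _; exact: cvg_fst.
have snd_cvg h (w : R * R) : h @ G --> w -> (h z).2 @[z --> G] --> w.2.
  by move=> hw; apply: cvg_comp hw _; exact: cvg_snd.
apply: continuous_cvg; first exact: sqrt_continuous.
by apply: cvgD; under eq_fun do rewrite expr2; rewrite expr2; apply: cvgM;
  apply: cvgB; (exact: fst_cvg || exact: snd_cvg).
Qed.

Lemma eucl_dist_ge0 (R : realType) (x y : R * R) : 0 <= eucl_dist x y.
Proof. exact: sqrtr_ge0. Qed.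

Lemma within_continuous_eucl_dist {R : realType} (D : set R) (f g : R -> R * R) :
  {within D, continuous f} -> {within D, continuous g} ->
  {within D, continuous (fun t => eucl_dist (f t) (g t))}.
Proof.
move=> /subspace_continuousP fc /subspace_continuousP gc.
apply/subspace_continuousP => t Dt.
apply: cvg_eucl_dist; [exact: fc|exact: gc].
Qed.

(** * Equicontinuity of normalised flexes *)

(** The square on the left makes the condition for [K] closed under pointwise
    limits without square roots; it is Hoelder continuity of exponent 1/2. *)
Definition bounded_half_holder {R : realType} (K : R) (f : R -> R) : Prop :=
  (forall t, t \in `[0, 1] -> `|f t| <= K) /\
  (forall s t, s \in `[0, 1] -> t \in `[0, 1] ->
    (f s - f t) ^+ 2 <= K * `|s - t|).

Lemma bounded_half_holder_le {R : realType} {K K' : R} {f : R -> R} :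
  K <= K' -> bounded_half_holder K f -> bounded_half_holder K' f.
Proof.
move=> KK' [fb fh]; split=> [t t01|s t s01 t01].
  exact: le_trans (fb t t01) KK'.
by apply: le_trans (fh s t s01 t01) _; rewrite ler_wpM2r.
Qed.

(** A point [(X, Y)] of the plane is recovered, up to the sign of [Y], from its
    distances to [(0, 0)] and [(d, 0)].  The Lipschitz constants are [L] for
    [X], read off [2 d X = r0^2 - r1^2 + d^2], and [N] for [Y^2 = r0^2 - X^2];
    on an interval of length 1 the first also gives exponent 1/2. *)
Lemma bounded_half_holder_of_base_dist {R : realType} (d B M : R) :
    0 < d -> 0 <= B -> 0 <= M ->
  exists K, forall X Y : R -> R,
    {within `[0, 1], continuous Y} ->
    (forall t, t \in `[0, 1] -> Num.sqrt (X t ^+ 2 + Y t ^+ 2) <= B) ->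
    (forall t, t \in `[0, 1] -> Num.sqrt ((X t - d) ^+ 2 + Y t ^+ 2) <= B) ->
    (forall s t, s \in `[0, 1] -> t \in `[0, 1] ->
      `|Num.sqrt (X s ^+ 2 + Y s ^+ 2) - Num.sqrt (X t ^+ 2 + Y t ^+ 2)|
        <= M * `|s - t|) ->
    (forall s t, s \in `[0, 1] -> t \in `[0, 1] ->
      `|Num.sqrt ((X s - d) ^+ 2 + Y s ^+ 2)
        - Num.sqrt ((X t - d) ^+ 2 + Y t ^+ 2)| <= M * `|s - t|) ->
  bounded_half_holder K X /\ bounded_half_holder K Y.
Proof.
move=> d0 B0 M0.
pose L := 2 * B * M / d.
pose N := 2 * B * M + 2 * B * L.
have L0 : 0 <= L by rewrite divr_ge0 ?(ltW d0)// !mulr_ge0.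
have N0 : 0 <= N by rewrite /N; move: L0; clearbody L => L0; rewrite addr_ge0 ?mulr_ge0.
exists (B + L ^+ 2 + 2 * N) => X Y Yc r0B r1B r0M r1M.
pose r0 t := Num.sqrt (X t ^+ 2 + Y t ^+ 2).
pose r1 t := Num.sqrt ((X t - d) ^+ 2 + Y t ^+ 2).
have r0E t : r0 t ^+ 2 = X t ^+ 2 + Y t ^+ 2.
  by rewrite sqr_sqrtr// addr_ge0// sqr_ge0.
have r1E t : r1 t ^+ 2 = (X t - d) ^+ 2 + Y t ^+ 2.
  by rewrite sqr_sqrtr// addr_ge0// sqr_ge0.
have r0L := @sqr_lipschitz _ r0 `[0, 1]%classic B M.
have r1L := @sqr_lipschitz _ r1 `[0, 1]%classic B M.
have {}r0L s t : s \in `[0, 1] -> t \in `[0, 1] ->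
    `|r0 s ^+ 2 - r0 t ^+ 2| <= 2 * B * M * `|s - t|.
  by apply: r0L => // z z01; rewrite ger0_norm ?sqrtr_ge0//; exact: r0B.
have {}r1L s t : s \in `[0, 1] -> t \in `[0, 1] ->
    `|r1 s ^+ 2 - r1 t ^+ 2| <= 2 * B * M * `|s - t|.
  by apply: r1L => // z z01; rewrite ger0_norm ?sqrtr_ge0//; exact: r1B.
have XB t : t \in `[0, 1] -> `|X t| <= B.
  move=> t01; apply: le_trans (r0B t t01); rewrite -sqrtr_sqr ler_wsqrtr//.
  by rewrite lerDl sqr_ge0.
have YB t : t \in `[0, 1] -> `|Y t| <= B.
  move=> t01; apply: le_trans (r0B t t01); rewrite -sqrtr_sqr ler_wsqrtr//.
  by rewrite lerDr sqr_ge0.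
have XL s t : s \in `[0, 1] -> t \in `[0, 1] -> `|X s - X t| <= L * `|s - t|.
  move=> s01 t01.
  have -> : X s - X t =
      ((r0 s ^+ 2 - r0 t ^+ 2) - (r1 s ^+ 2 - r1 t ^+ 2)) / (2 * d).
    by rewrite !r0E !r1E; field; rewrite gt_eqF.
  rewrite normrM normfV (gtr0_norm (_ : 0 < 2 * d)) ?mulr_gt0//.
  rewrite ler_pdivrMr ?mulr_gt0//.
  have -> : L * `|s - t| * (2 * d) =
      2 * B * M * `|s - t| + 2 * B * M * `|s - t|.
    by rewrite /L; field; rewrite gt_eqF.
  by rewrite (le_trans (ler_normB _ _))// lerD// (r0L, r1L).
have X2L := @sqr_lipschitz _ X `[0, 1]%classic B L XB XL.
have Y2L s t : s \in `[0, 1] -> t \in `[0, 1] ->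
    `|Y s ^+ 2 - Y t ^+ 2| <= N * `|s - t|.
  move=> s01 t01.
  have -> : Y s ^+ 2 - Y t ^+ 2 =
      (r0 s ^+ 2 - r0 t ^+ 2) - (X s ^+ 2 - X t ^+ 2).
    by rewrite !r0E; ring.
  by rewrite mulrDl (le_trans (ler_normB _ _))// lerD ?r0L ?X2L.
split.
  apply: (@bounded_half_holder_le _ (B + L ^+ 2)); first by rewrite lerDl mulr_ge0.
  split=> [t t01|s t s01 t01].
    by rewrite (le_trans (XB t t01))// lerDl sqr_ge0.
  have st1 : `|s - t| <= 1.
    move: s01 t01; rewrite !in_itv /= => /andP[? ?] /andP[? ?].
    by rewrite ler_norml; apply/andP; split; lra.
  have := XL s t s01 t01; rewrite -ler_sqr ?nnegrE ?(mulr_ge0 L0)//.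
  rewrite real_normK ?num_real// => /le_trans; apply.
  rewrite mulrDl exprMn (le_trans _ (_ : L ^+ 2 * `|s - t| <= _))//.
    by rewrite ler_wpM2l ?sqr_ge0// expr2 ler_piMl.
  by rewrite lerDr mulr_ge0.
apply: (@bounded_half_holder_le _ (B + 2 * N)).
  by rewrite lerD2r lerDl sqr_ge0.
split=> [t t01|s t s01 t01].
  by rewrite (le_trans (YB t t01))// lerDl mulr_ge0.
apply: le_trans (sqr_dist_le_of_sqr_lipschitz Yc Y2L _ _ s01 t01) _.
by rewrite ler_wpM2r// lerDr.
Qed.

(** The constant depends on the vertex, the framework and [M], but on neither
    the flex nor the subframework being flexed: the distances from the moving
    vertex to the base vertices start at values given by the framework and
    vary by at most [M] over [`[0, 1]]. *)
Lemma normalised_smooth_flex_bound {R : realType} {F : framework R nat} {M : R}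
    (x : nat) : normalised_framework F -> 0 <= M ->
  exists K, forall W q, smooth_flex F W M q -> normalised_flex F W q -> W x ->
    bounded_half_holder K (fun t => (q t x).1) /\
    bounded_half_holder K (fun t => (q t x).2).
Proof.
move=> [_ d_neq0 pos0 pos1] M0.
set d := eucl_dist _ _ in d_neq0 pos1.
have d0 : 0 < d by rewrite lt_neqAle eq_sym d_neq0 eucl_dist_ge0.
pose B := eucl_dist (pos F x) (pos F 0%N) + eucl_dist (pos F x) (pos F 1%N) + M.
have B0 : 0 <= B by rewrite !addr_ge0 ?eucl_dist_ge0.
have [K KP] := bounded_half_holder_of_base_dist _ _ _ d0 B0 M0.
exists K => W q [_ _ qM] [q0 qc [W0 W1 _ _ qbase] _ _] Wx.
have zero01 : (0 : R) \in `[0, 1] by rewrite in_itv /= lexx ler01.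
have qt0 t : t \in `[0, 1] -> q t 0%N = (0, 0).
  by move=> /qbase[-> _]; rewrite q0.
have qt1 t : t \in `[0, 1] -> q t 1%N = (d, 0).
  by move=> /qbase[_ ->]; rewrite q0.
have rE0 t : t \in `[0, 1] ->
    Num.sqrt ((q t x).1 ^+ 2 + (q t x).2 ^+ 2) = eucl_dist (q t x) (q t 0%N).
  by move=> t01; rewrite /eucl_dist qt0//= !subr0.
have rE1 t : t \in `[0, 1] ->
    Num.sqrt (((q t x).1 - d) ^+ 2 + (q t x).2 ^+ 2) =
    eucl_dist (q t x) (q t 1%N).
  by move=> t01; rewrite /eucl_dist qt1//= subr0.
have rL y : W y -> forall s t, s \in `[0, 1] -> t \in `[0, 1] ->
    `|eucl_dist (q s x) (q s y) - eucl_dist (q t x) (q t y)| <= M * `|s - t|.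
  move=> Wy; apply: lipschitz_of_derivative_bound; last exact: qM.
  by apply: within_continuous_eucl_dist; exact: qc.
have rB y t : W y -> t \in `[0, 1] ->
    eucl_dist (q t x) (q t y) <= eucl_dist (pos F x) (pos F y) + M.
  move=> Wy t01; rewrite -(q0 x)// -(q0 y)// -lerBlDl.
  apply: le_trans (ler_norm _) _.
  apply: le_trans (rL y Wy t 0 t01 zero01) _.
  move: t01; rewrite in_itv /= subr0 => /andP[t0 t1].
  by rewrite ger0_norm// ler_piMr.
apply: KP.
- have /subspace_continuousP qcx := qc x Wx.
  apply/subspace_continuousP => t t01.
  by apply: cvg_comp (qcx t t01) _; exact: cvg_snd.
- move=> t t01; rewrite rE0// (le_trans (rB _ _ W0 t01))//.
  by rewrite lerD2r lerDl eucl_dist_ge0.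
- move=> t t01; rewrite rE1// (le_trans (rB _ _ W1 t01))//.
  by rewrite lerD2r lerDr eucl_dist_ge0.
- by move=> s t s01 t01; rewrite !rE0//; exact: rL.
- by move=> s t s01 t01; rewrite !rE1//; exact: rL.
Qed.

(** * Limits along an ultrafilter *)

(** A set [A] in a filter finer than [f @ U] has its preimage in [U]: otherwise
    the preimage of its complement would be in [U]. *)
Lemma ultra_fmap {S T : Type} (U : set_system S) (f : S -> T) :
  UltraFilter U -> UltraFilter (f @ U).
Proof.
move=> UU; have UP : ProperFilter U by exact: ultra_proper.
split=> [|G GP fUG]; first exact: fmap_proper_filter.
apply/seteqP; split=> // A GA.
have [//|UnA] := in_ultra_setVsetC (f @^-1` A) UU.
have [z [Az nAz]] := filter_ex (filterI GA (fUG (~` A) UnA)).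
by [].
Qed.

Lemma bounded_ultra_cvg {R : realType} {S : Type} (U : set_system S) (u : S -> R)
    (K : R) :
  UltraFilter U -> (\forall z \near U, `|u z| <= K) -> exists l : R, u @ U --> l.
Proof.
move=> UU uK; have := @segment_compact R (- K) K.
rewrite compact_ultra => /(_ _ (ultra_fmap U u UU))[|l [_ ul]]; last by exists l.
by apply: filterS uK => z /=; rewrite in_itv /= ler_norml.
Qed.

(** This replaces the extraction of a convergent subsequence: one ultrafilter
    serves all times, and later all vertices, simultaneously. *)
Lemma bounded_half_holder_limit {R : realType} {S : Type} (U : set_system S)
    (f : S -> R -> R) (K : R) :
    UltraFilter U -> (\forall z \near U, bounded_half_holder K (f z)) ->
  exists g : R -> R, bounded_half_holder K g /\
    forall t, t \in `[0, 1] -> f z t @[z --> U] --> g t.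
Proof.
move=> UU fK; have UP : ProperFilter U by exact: ultra_proper.
have lim_ex t : exists l : R, t \in `[0, 1] -> f z t @[z --> U] --> l.
  have [t01|_] := boolP (t \in `[0, 1]); last by exists 0.
  have [|l fl] := bounded_ultra_cvg U (f ^~ t) K UU; last by exists l.
  by apply: filterS fK => z [fb _]; exact: fb.
have [g gP] := choice lim_ex.
exists g; split=> //; split=> [t t01|s t s01 t01].
  apply: cvgr_to_le (cvg_norm (gP t t01)) _.
  by apply: filterS fK => z [fb _]; exact: fb.
have f_st : (f z s - f z t) @[z --> U] --> g s - g t.
  exact: cvgB (gP s s01) (gP t t01).
rewrite expr2; apply: cvgr_to_le (cvgM f_st f_st) _.
by apply: filterS fK => z [_ fh]; rewrite /= -expr2; exact: fh.
Qed.

(** Used to carry the identities satisfied by the finite flexes, each valid from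
    some index on, over to the limit flex. *)
Lemma limit_near_eq {R : numFieldType} {V : pseudoMetricNormedZmodType R}
    {S : Type} {U : set_system S} {UP : ProperFilter U} {f g : S -> V} {a b : V} :
  (\forall z \near U, f z = g z) -> f @ U --> a -> g @ U --> b -> a = b.
Proof.
move=> fg fa gb; have ga : g @ U --> a by apply: cvg_trans fa; exact: near_eq_cvg.
exact: norm_cvg_unique ga gb.
Qed.

(** * The limit flex *)

Theorem theorem4p2 (R : realType) (F : framework R nat)
    (F_locally_finite : locally_finite F)
    (F_connected : induced_connected F setT)
    (F_normalised : normalised_framework F)
    (V : nat -> set nat) (V_chain : standard_chain F V)
    (i j : nat) (Vi : V 0%N i) (Vj : V 0%N j)
    (flexes : exists (M c : R) (q : nat -> R -> nat -> R * R),
      [/\ 0 < M, 0 < c,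
          (forall r, smooth_flex F (V r) M (q r)),
          (forall r, normalised_flex F (V r) (q r)) &
          (forall r, c <= `| eucl_dist (q r 1 i) (q r 1 j)
                            - eucl_dist (q r 0 i) (q r 0 j) |)]) :
  continuously_flexible F setT.
Proof.
have [M [c [q [M0 c0 q_smooth q_norm q_move]]]] := flexes.
have [V_step _ V_cover _] := V_chain.
have V_mono r r' : (r <= r')%N -> V r `<=` V r'.
  move=> /subnK <-; elim: (r' - r)%N => [//|n IH] x Vx.
  by rewrite addSn; exact/V_step/IH.
have [U [UU U_infty]] := ultraFilterLemma eventually_filter.
have UP : ProperFilter U by exact: ultra_proper.
have U_V x : \forall n \near U, V n x.
  have [r _ Vx] : (\bigcup_r V r) x by rewrite V_cover.
  apply: U_infty; exists r => // n /= rn; exact: V_mono Vx.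
have lim_ex x : exists Q : R -> R * R,
    {within `[0, 1], continuous Q} /\
    forall t, t \in `[0, 1] -> q n t x @[n --> U] --> Q t.
  have [K KP] := normalised_smooth_flex_bound x F_normalised (ltW M0).
  have qK : \forall n \near U, bounded_half_holder K (fun t => (q n t x).1) /\
                               bounded_half_holder K (fun t => (q n t x).2).
    by apply: filterS (U_V x) => n Vnx; exact: KP (q_smooth n) (q_norm n) Vnx.
  have [X [[_ XK] qX]] : exists g, bounded_half_holder K g /\
      forall t, t \in `[0, 1] -> (q n t x).1 @[n --> U] --> g t.
    by apply: bounded_half_holder_limit; apply: filterS qK => n [].
  have [Y [[_ YK] qY]] : exists g, bounded_half_holder K g /\
      forall t, t \in `[0, 1] -> (q n t x).2 @[n --> U] --> g t.
    by apply: bounded_half_holder_limit; apply: filterS qK => n [].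
  exists (fun t => (X t, Y t)); split=> [|t t01].
    have /subspace_continuousP Xc :=
      within_continuous_of_sqr_dist_le X `[0, 1]%classic K XK.
    have /subspace_continuousP Yc :=
      within_continuous_of_sqr_dist_le Y `[0, 1]%classic K YK.
    apply/subspace_continuousP => t t01.
    exact: cvg_pair (Xc t t01) (Yc t t01).
  rewrite (funext (fun n => surjective_pairing (q n t x))).
  exact: cvg_pair (qX t t01) (qY t t01).
have {lim_ex}[Q QP] := choice lim_ex.
have [zero01 one01] : (0 : R) \in `[0, 1] /\ (1 : R) \in `[0, 1].
  by rewrite !in_itv /= !lexx !ler01.
have dist_lim x y t : t \in `[0, 1] ->
    eucl_dist (q n t x) (q n t y) @[n --> U] --> eucl_dist (Q x t) (Q y t).
  move=> t01; apply: cvg_eucl_dist.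
    exact: (QP x).2 t t01.
  exact: (QP y).2 t t01.
have [F01 d_neq0 _ _] := F_normalised.
exists (fun t x => Q x t), 0%N, 1%N; split.
- move=> x _; apply: (limit_near_eq _ ((QP x).2 0 zero01) (cvg_cst _)).
  by apply: filterS (U_V x) => n Vnx; have [q0 _ _ _ _] := q_norm n; exact: q0.
- by move=> x _; exact: (QP x).1.
- split=> // t t01.
  have base n : q n t 0%N = q n 0 0%N /\ q n t 1%N = q n 0 1%N.
    by have [_ _ [_ _ _ _ base] _ _] := q_norm n; exact: base.
  split; apply: (limit_near_eq _ ((QP _).2 t t01) ((QP _).2 0 zero01)).
    by apply: nearW => n; exact: (base n).1.
  by apply: nearW => n; exact: (base n).2.
- move=> x y _ _ Fxy t t01.
  apply: (limit_near_eq _ (dist_lim x y t t01) (dist_lim x y 0 zero01)).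
  apply: filterS2 (U_V x) (U_V y) => n Vx Vy.
  by have [_ _ _ qd _] := q_norm n; exact: qd.
- move=> /(_ 0 1 zero01 one01) Q01.
  have c_le : c <= `|eucl_dist (Q i 1) (Q j 1) - eucl_dist (Q i 0) (Q j 0)|.
    apply: cvgr_to_ge (cvg_norm (cvgB (dist_lim i j 1 one01) (dist_lim i j 0 zero01))) _.
    by apply: nearW => n; exact: q_move.
  by move: c_le; rewrite !Q01// subrr normr0 leNgt c0.
Qed.
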